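(* ${DL}(\partial_{||})$ is not more expressive than ${DL}(\partial)$ with respect to addition of rules: there is a propositional defeasible theory $D$ such that no propositional defeasible theory $D'$ in ${DL}(\partial_{||})$ simulates $D$ in ${DL}(\partial)$ with respect to addition of rules.
   Context: Literals are propositions or their negations; ${\sim}q$ is the complement of $q$. A propositional defeasible theory is $D=(F,R,>)$: $F$ finite set of literals, $R$ finite set of labelled rules, $>$ acyclic binary relation on $R$. Each rule has a finite antecedent set $A(r)$ and consequent literal and is strict ($\rightarrow$), defeasible ($\Rightarrow$) or a defeater ($\leadsto$). $R_s$: strict rules; $R_{sd}$: strict and defeasible rules; $R[q]$: rules with consequent $q$. A proof $P$ is a sequence of tagged literals, $P(1..i)$ its first $i$ elements; a conclusion is a consequence if it occurs in some proof. $\Sigma(D)$ is the set of propositions and $\Lambda(D)$ the set of rule/fact labels of $D$. $+\Delta$: append $+\Delta q$ if $q\in F$ or some $r\in R_s[q]$ has $+\Delta a\in P(1..i)$ for all $a\in A(r)$. $-\Delta$: append $-\Delta q$ if $q\notin F$ and every $r\in R_s[q]$ has some $a\in A(r)$ with $-\Delta a\in P(1..i)$. ${DL}(\partial)$: tags $\Delta,\partial$. $+\partial$: append $+\partial q$ if (1) $+\Delta q\in P(1..i)$, or (2.1) some $r\in R_{sd}[q]$ has $+\partial a\in P(1..i)$ for all $a\in A(r)$, (2.2) $-\Delta{\sim}q\in P(1..i)$, (2.3) every $s\in R[{\sim}q]$ has some $a\in A(s)$ with $-\partial a\in P(1..i)$, or some $t\in R_{sd}[q]$ with $t>s$ has $+\partial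 a\in P(1..i)$ for all $a\in A(t)$. $-\partial$: append $-\partial q$ if $-\Delta q\in P(1..i)$ and either every $r\in R_{sd}[q]$ has some $a\in A(r)$ with $-\partial a\in P(1..i)$, or $+\Delta{\sim}q\in P(1..i)$, or some $s\in R[{\sim}q]$ has $+\partial a\in P(1..i)$ for all $a\in A(s)$ and every $t\in R_{sd}[q]$ either has some $a\in A(t)$ with $-\partial a\in P(1..i)$ or not $t>s$. ${DL}(\partial_{||})$: tags $\Delta,\lambda,\partial_{||}$. $P_\Delta$: all $\pm\Delta$ conclusions derivable. $+\lambda$: append $+\lambda q$ if $+\Delta q\in P_\Delta$, or some $r\in R_{sd}[q]$ has $+\lambda a\in P(1..i)$ for all $a\in A(r)$ and $+\Delta{\sim}q\notin P_\Delta$. $-\lambda$: append $-\lambda q$ if $-\Delta q\in P_\Delta$ and either every $r\in R_{sd}[q]$ has some $a\in A(r)$ with $-\lambda a\in P(1..i)$, or $+\Delta{\sim}q\in P_\Delta$. $P_\lambda$: all $\pm\lambda$ conclusions derivable. $+\partial_{||}$: append $+\partial_{||}q$ if (1) $+\Delta q\in P_\Delta$, or (2.1) some $r\in R_{sd}[q]$ has $+\partial_{||}a\in P(1..i)$ for all $a\in A(r)$, (2.2) $+\Delta{\sim}q\notin P_\Delta$, (2.3) every $s\in R[{\sim}q]$ has some $a\in A(s)$ with $+\lambda a\notin P_\lambda$, or some $t\in R_{sd}[q]$ with $t>s$ has $+\partial_{||}a\in P(1..i)$ for all $a\in A(t)$. $-\partial_{||}$: append $-\partial_{||}q$ if $-\Delta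 q\in P_\Delta$ and either every $r\in R_{sd}[q]$ has some $a\in A(r)$ with $-\partial_{||}a\in P(1..i)$, or $+\Delta{\sim}q\in P_\Delta$, or some $s\in R[{\sim}q]$ has $+\lambda a\in P_\lambda$ for all $a\in A(s)$ and every $t\in R_{sd}[q]$ either has some $a\in A(t)$ with $-\partial_{||}a\in P(1..i)$ or not $t>s$. The addition of theories is $(F_1,R_1,>_1)+(F_2,R_2,>_2)=(F_1\cup F_2,R_1\cup R_2,>_1\cup>_2)$. Given $D$ and a candidate simulating theory $D'$, an addition $A$ is modular if $\Sigma(A)\cap\Sigma(D')\subseteq\Sigma(D)$, $\Lambda(D)\cap\Lambda(A)=\emptyset$ and $\Lambda(D')\cap\Lambda(A)=\emptyset$. $D$ in ${DL}(\partial)$ is simulated by $D'$ in ${DL}(\partial_{||})$ with respect to addition of rules if for every modular addition $A$ consisting only of rules (no facts, empty superiority relation), $D+A$ and $D'+A$ have the same consequences on literals over $\Sigma(D+A)$ modulo tags: $\pm\Delta q$ is a consequence of $D+A$ iff of $D'+A$, and $\pm\partial q$ is a consequence of $D+A$ in ${DL}(\partial)$ iff $\pm\partial_{||}q$ is a consequence of $D'+A$ in ${DL}(\partial_{||})$. *)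

(* Defs.v *)
From HB Require Import structures.
From mathcomp Require Import all_boot finmap.

Set Implicit Arguments.
Unset Strict Implicit.
Unset Printing Implicit Defensive.

Local Open Scope fset_scope.

(* Countably infinite supplies of names. *)
Definition proposition := nat.
Definition label := nat.

(* (p, true) is the literal p and (p, false) its negation. *)
Definition literal := (proposition * bool)%type.
Definition compl (q : literal) : literal := (q.1, ~~ q.2).

Inductive rule_kind := Strict | Defeasible | Defeater.

Definition rule_kind_code (k : rule_kind) : nat :=
  match k with Strict => 0 | Defeasible => 1 | Defeater => 2 end.
Definition rule_kind_decode (n : nat) : rule_kind :=
  match n with 0 => Strict | 1 => Defeasible | _ => Defeater end.
Lemma rule_kind_codeK : cancel rule_kind_code rule_kind_decode.
Proof. by case. Qed.
HB.instance Definition _ := Countable.copy rule_kind (can_type rule_kind_codeK).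

Record rule := Rule {
  rlabel : label;
  rkind : rule_kind;
  body : {fset literal};
  head : literal
}.

Definition rule_code (r : rule) := (rlabel r, rkind r, body r, head r).
Definition rule_decode (x : label * rule_kind * {fset literal} * literal) :=
  let: (l, k, b, h) := x in Rule l k b h.
Lemma rule_codeK : cancel rule_code rule_decode.
Proof. by case. Qed.
HB.instance Definition _ := Choice.copy rule (can_type rule_codeK).

(* [(r, s) \in superiority D] stands for r > s.  Facts carry labels, which
   only matter for [Lambda]; the set F of the theory is [facts] below. *)
Record theory := Theory {
  labelled_facts : {fset label * literal};
  rules : {fset rule};
  superiority : {fset rule * rule}
}.

Definition facts (D : theory) : {fset literal} :=
  [fset f.2 | f in labelled_facts D].

Definition superior (D : theory) : rel rule :=
  fun r s => (r, s) \in superiority D.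

Definition rule_labels (D : theory) : {fset label} :=
  [fset rlabel r | r in rules D].
Definition fact_labels (D : theory) : {fset label} :=
  [fset f.1 | f in labelled_facts D].
Definition Lambda (D : theory) : {fset label} := rule_labels D `|` fact_labels D.

Definition props_of (L : {fset literal}) : {fset proposition} :=
  [fset l.1 | l in L].
Definition Sigma (D : theory) : {fset proposition} :=
  props_of (facts D) `|` \bigcup_(r <- rules D) props_of (head r |` body r).

Definition acyclic (gt : rel rule) : Prop :=
  forall c : seq rule, cycle gt c -> c = [::].

(* The first three conditions say that a label names a single rule or fact. *)
Record defeasible_theory (D : theory) : Prop := DefeasibleTheory {
  rlabel_inj : {in rules D &, injective rlabel};
  flabel_inj : {in labelled_facts D &, injective fst};
  labels_disj : rule_labels D `&` fact_labels D = fset0;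
  sup_rules : forall r s, superior D r s -> r \in rules D /\ s \in rules D;
  sup_acyclic : acyclic (superior D)
}.

Definition Rs (D : theory) (q : literal) : {fset rule} :=
  [fset r in rules D | (rkind r == Strict) && (head r == q)].
Definition Rsd (D : theory) (q : literal) : {fset rule} :=
  [fset r in rules D | (rkind r != Defeater) && (head r == q)].
Definition Rall (D : theory) (q : literal) : {fset rule} :=
  [fset r in rules D | head r == q].

Definition add (D1 D2 : theory) : theory :=
  Theory (labelled_facts D1 `|` labelled_facts D2)
         (rules D1 `|` rules D2)
         (superiority D1 `|` superiority D2).

Inductive tag := Delta | Lam | Partial | PartialPar.

Definition tag_code (t : tag) : nat :=
  match t with Delta => 0 | Lam => 1 | Partial => 2 | PartialPar => 3 end.
Definition tag_decode (n : nat) : tag :=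
  match n with 0 => Delta | 1 => Lam | 2 => Partial | _ => PartialPar end.
Lemma tag_codeK : cancel tag_code tag_decode.
Proof. by case. Qed.
HB.instance Definition _ := Countable.copy tag (can_type tag_codeK).

(* The boolean is the sign of the conclusion: true for +, false for -. *)
Definition conclusion := (bool * tag * literal)%type.
Definition plus (t : tag) (q : literal) : conclusion := (true, t, q).
Definition minus (t : tag) (q : literal) : conclusion := (false, t, q).

Definition concl_set := conclusion -> Prop.

(* A system of inference rules: [I X c] means that c may be appended to a
   proof whose elements so far form the set X. *)
Definition inference := concl_set -> conclusion -> Prop.

Inductive is_proof (I : inference) : seq conclusion -> Prop :=
| proof_nil : is_proof I [::]
| proof_append (P : seq conclusion) (c : conclusion) :
    is_proof I P -> I (fun x => x \in P) c -> is_proof I (rcons P c).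

Definition consequence (I : inference) (c : conclusion) : Prop :=
  exists2 P, is_proof I P & c \in P.

Definition all_plus (X : concl_set) (t : tag) (r : rule) : Prop :=
  forall a, a \in body r -> X (plus t a).
Definition some_minus (X : concl_set) (t : tag) (r : rule) : Prop :=
  exists2 a, a \in body r & X (minus t a).
Definition some_not_plus (X : concl_set) (t : tag) (r : rule) : Prop :=
  exists2 a, a \in body r & ~ X (plus t a).

Definition plus_Delta (D : theory) (X : concl_set) (q : literal) : Prop :=
  q \in facts D \/ exists2 r, r \in Rs D q & all_plus X Delta r.

Definition minus_Delta (D : theory) (X : concl_set) (q : literal) : Prop :=
  q \notin facts D /\ forall r, r \in Rs D q -> some_minus X Delta r.

Definition plus_Partial (D : theory) (X : concl_set) (q : literal) : Prop :=
  X (plus Delta q) \/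
  [/\ exists2 r, r \in Rsd D q & all_plus X Partial r,
      X (minus Delta (compl q))
    & forall s, s \in Rall D (compl q) ->
        some_minus X Partial s \/
        exists t, [/\ t \in Rsd D q, superior D t s & all_plus X Partial t]].

Definition minus_Partial (D : theory) (X : concl_set) (q : literal) : Prop :=
  X (minus Delta q) /\
  [\/ forall r, r \in Rsd D q -> some_minus X Partial r,
      X (plus Delta (compl q))
    | exists s, [/\ s \in Rall D (compl q), all_plus X Partial s
        & forall t, t \in Rsd D q ->
            some_minus X Partial t \/ ~ superior D t s]].

Definition infer_Delta (D : theory) : inference := fun X c =>
  match c with
  | (true, Delta, q) => plus_Delta D X q
  | (false, Delta, q) => minus_Delta D X q
  | _ => False
  end.

Definition DL_partial (D : theory) : inference := fun X c =>
  match c with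
  | (_, Delta, _) => infer_Delta D X c
  | (true, Partial, q) => plus_Partial D X q
  | (false, Partial, q) => minus_Partial D X q
  | _ => False
  end.

Definition P_Delta (D : theory) : concl_set := consequence (infer_Delta D).

Definition plus_Lam (D : theory) (X : concl_set) (q : literal) : Prop :=
  P_Delta D (plus Delta q) \/
  ((exists2 r, r \in Rsd D q & all_plus X Lam r) /\
   ~ P_Delta D (plus Delta (compl q))).

Definition minus_Lam (D : theory) (X : concl_set) (q : literal) : Prop :=
  P_Delta D (minus Delta q) /\
  ((forall r, r \in Rsd D q -> some_minus X Lam r) \/
   P_Delta D (plus Delta (compl q))).

Definition infer_Lam (D : theory) : inference := fun X c =>
  match c with
  | (true, Lam, q) => plus_Lam D X q
  | (false, Lam, q) => minus_Lam D X q
  | _ => False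
  end.

Definition P_Lam (D : theory) : concl_set := consequence (infer_Lam D).

Definition plus_PartialPar (D : theory) (X : concl_set) (q : literal) : Prop :=
  P_Delta D (plus Delta q) \/
  [/\ exists2 r, r \in Rsd D q & all_plus X PartialPar r,
      ~ P_Delta D (plus Delta (compl q))
    & forall s, s \in Rall D (compl q) ->
        some_not_plus (P_Lam D) Lam s \/
        exists t, [/\ t \in Rsd D q, superior D t s & all_plus X PartialPar t]].

Definition minus_PartialPar (D : theory) (X : concl_set) (q : literal) : Prop :=
  P_Delta D (minus Delta q) /\
  [\/ forall r, r \in Rsd D q -> some_minus X PartialPar r,
      P_Delta D (plus Delta (compl q))
    | exists s, [/\ s \in Rall D (compl q), all_plus (P_Lam D) Lam s
        & forall t, t \in Rsd D q ->
            some_minus X PartialPar t \/ ~ superior D t s]].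

Definition DL_partial_par (D : theory) : inference := fun X c =>
  match c with
  | (_, Delta, _) => infer_Delta D X c
  | (_, Lam, _) => infer_Lam D X c
  | (true, PartialPar, q) => plus_PartialPar D X q
  | (false, PartialPar, q) => minus_PartialPar D X q
  | _ => False
  end.

Definition modular (D D' A : theory) : Prop :=
  [/\ Sigma A `&` Sigma D' `<=` Sigma D,
      Lambda D `&` Lambda A = fset0
    & Lambda D' `&` Lambda A = fset0].

Definition only_rules (A : theory) : Prop :=
  labelled_facts A = fset0 /\ superiority A = fset0.

(* D in DL(partial) is simulated by D' in DL(partial_||) with respect to
   addition of rules. *)
Definition simulated_by (D D' : theory) : Prop :=
  forall A : theory,
    defeasible_theory A -> only_rules A -> modular D D' A ->
    forall (sgn : bool) (q : literal), q.1 \in Sigma (add D A) ->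
      (consequence (DL_partial (add D A)) (sgn, Delta, q) <->
       consequence (DL_partial_par (add D' A)) (sgn, Delta, q)) /\
      (consequence (DL_partial (add D A)) (sgn, Partial, q) <->
       consequence (DL_partial_par (add D' A)) (sgn, PartialPar, q)).

(* Main.v *)
From Stdlib Require Import Lia.
From mathcomp Require Import all_boot finmap.
Require Import Defs.

Set Implicit Arguments.
Unset Strict Implicit.
Unset Printing Implicit Defensive.

Local Open Scope fset_scope.

(** The empty theory cannot be simulated.  Given D', add the rules
    [=> p], [=> ~p], [=> q], [p => ~q] over propositions p, q that do not occur
    in D'.  In DL(partial) the ambiguity of p is blocked: [p] is refuted, the
    attack on [q] fails and [q] is concluded.  In DL(partial_||) the literal
    [p] is still supported (+lambda), so the attack on [q] stands; only a
    superior rule could defeat it, but D' cannot mention the attacking rule. *)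

Lemma fset_nat_bounded (S : {fset nat}) : exists n, forall x, x \in S -> x < n.
Proof.
exists (\max_(x <- S) x).+1 => x xS; rewrite ltnS.
exact: leq_bigmax_seq.
Qed.

(** Only the condition under which [c] was appended is kept. That [P] is itself a proof is dropped:
    the refutations below rest on parts of the condition that fail for every [P]. *)
Lemma consequence_last_step (I : inference) (c : conclusion) :
  consequence I c -> exists P : seq conclusion, I (fun x => x \in P) c.
Proof.
case=> P; elim=> [//|{}P d _ IH Id].
by rewrite mem_rcons inE => /predU1P[->|/IH//]; exists P.
Qed.

Lemma consequence_seq1 (I : inference) (c : conclusion) :
  I (fun x => x \in [::]) c -> consequence I c.
Proof.
move=> Ic; exists [:: c]; last exact: mem_head.
exact: (proof_append (proof_nil I)).
Qed.

Lemma fact_Sigma (D : theory) (q : literal) : q \in facts D -> q.1 \in Sigma D.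
Proof. by move=> qD; rewrite in_fsetU in_imfset. Qed.

Lemma head_Sigma (D : theory) (r : rule) : r \in rules D -> (head r).1 \in Sigma D.
Proof.
move=> rD; rewrite in_fsetU; apply/orP; right.
apply/bigfcupP; exists r; first by rewrite rD.
by apply: in_imfset; apply: fset1U1.
Qed.

Lemma facts_add (D1 D2 : theory) : facts (add D1 D2) = facts D1 `|` facts D2.
Proof. exact: imfsetU. Qed.

Lemma facts_only_rules (A : theory) : only_rules A -> facts A = fset0.
Proof. by case=> FA _; rewrite /facts FA imfset0. Qed.

Lemma not_plus_Delta (D : theory) (q : literal) :
  q \notin facts D -> Rs D q = fset0 -> ~ P_Delta D (plus Delta q).
Proof.
move=> qF Rq /consequence_last_step[P [qF'|[r]]]; first by rewrite qF' in qF.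
by rewrite Rq in_fset0.
Qed.

Lemma Rs_notin_Sigma (D A : theory) (q : literal) :
  q.1 \notin Sigma D -> (forall r, r \in rules A -> rkind r != Strict) ->
  Rs (add D A) q = fset0.
Proof.
move=> qD nsA; apply/fsetP=> r; rewrite !inE /=.
apply/negP=> /andP[/orP[rD|rA] /andP[rs /eqP rq]].
  by move: qD; rewrite -rq head_Sigma.
by move: (nsA r rA); rewrite rs.
Qed.

Lemma in_Rsd (D : theory) (r : rule) :
  r \in rules D -> rkind r != Defeater -> r \in Rsd D (head r).
Proof. by move=> rD rk; rewrite !inE rD rk eqxx. Qed.

Lemma in_Rall (D : theory) (r : rule) : r \in rules D -> r \in Rall D (head r).
Proof. by move=> rD; rewrite !inE rD eqxx. Qed.

Definition empty_theory : theory := Theory fset0 fset0 fset0.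

Lemma superior_only_rules (D A : theory) (t s : rule) :
  only_rules A -> superior (add D A) t s -> superior D t s.
Proof. by case=> _ supA; rewrite /superior /= supA fsetU0. Qed.

Lemma only_rules_superior (A : theory) (t s : rule) :
  only_rules A -> ~ superior A t s.
Proof. by case=> _ supA; rewrite /superior supA in_fset0. Qed.

Lemma only_rules_defeasible (A : theory) :
  only_rules A -> {in rules A &, injective rlabel} -> defeasible_theory A.
Proof.
move=> orA injA; have [FA _] := orA; split=> //.
- by move=> x y; rewrite FA in_fset0.
- by rewrite /fact_labels FA imfset0 fsetI0.
- by move=> r s /(only_rules_superior orA).
- case=> [//|r [|s c]] /= /andP[rs _]; by case: (only_rules_superior orA rs).
Qed.

Lemma empty_theory_defeasible : defeasible_theory empty_theory.
Proof. by apply: only_rules_defeasible => // x y; rewrite in_fset0. Qed.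

(** The four rules carry the consecutive labels n to n+3, so they are distinct, and a single n above
    all labels of D' keeps them disjoint from [Lambda D']. *)
Definition ambig_for (p : proposition) (n : label) : rule :=
  Rule n Defeasible fset0 (p, true).
Definition ambig_against (p : proposition) (n : label) : rule :=
  Rule n.+1 Defeasible fset0 (p, false).
Definition target_rule (q : proposition) (n : label) : rule :=
  Rule n.+2 Defeasible fset0 (q, true).
Definition attack_rule (p q : proposition) (n : label) : rule :=
  Rule n.+3 Defeasible [fset (p, true)] (q, false).

Definition ambiguous_addition (p q : proposition) (n : label) : theory :=
  Theory fset0 [fset ambig_for p n; ambig_against p n; target_rule q n;
                     attack_rule p q n] fset0.

Lemma ambiguous_rulesP (p q : proposition) (n : label) (r : rule) :
  reflect [\/ r = ambig_for p n, r = ambig_against p n, r = target_rule q n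
            | r = attack_rule p q n]
          (r \in rules (ambiguous_addition p q n)).
Proof.
rewrite !inE -!orbA; apply: (iffP idP).
  by case/or4P=> /eqP->; constructor.
by case=> ->; rewrite eqxx ?orbT.
Qed.

Lemma ambiguous_not_strict (p q : proposition) (n : label) (r : rule) :
  r \in rules (ambiguous_addition p q n) -> rkind r != Strict.
Proof. by case/ambiguous_rulesP=> ->. Qed.

Lemma ambiguous_only_rules (p q : proposition) (n : label) :
  only_rules (ambiguous_addition p q n).
Proof. by []. Qed.

Lemma ambiguous_defeasible (p q : proposition) (n : label) :
  defeasible_theory (ambiguous_addition p q n).
Proof.
apply: only_rules_defeasible => // r s.
by case/ambiguous_rulesP=> -> /ambiguous_rulesP[] -> //=; lia.
Qed.

Lemma ambiguous_Sigma (p q : proposition) (n : label) (x : proposition) :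
  x \in Sigma (ambiguous_addition p q n) -> x = p \/ x = q.
Proof.
rewrite in_fsetU facts_only_rules // /props_of imfset0 in_fset0 /=.
case/bigfcupP=> r; rewrite andbT => /ambiguous_rulesP rA /imfsetP[l /=].
by case: rA => -> /=; rewrite !inE ?orbF => lr ->; move: lr;
  try case/orP; move/eqP->; auto.
Qed.

Lemma ambiguous_Lambda (p q : proposition) (n l : label) :
  l \in Lambda (ambiguous_addition p q n) -> n <= l.
Proof.
rewrite in_fsetU /fact_labels imfset0 in_fset0 orbF.
by case/imfsetP=> r /ambiguous_rulesP[] -> -> /=; rewrite ?leqW.
Qed.

(** As [Sigma empty_theory] is empty, modularity forbids any proposition shared with D'; hence p and
    q must both be fresh. *)
Lemma ambiguous_modular (D' : theory) (p q : proposition) (n : label) :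
  p \notin Sigma D' -> q \notin Sigma D' -> (forall l, l \in Lambda D' -> l < n) ->
  modular empty_theory D' (ambiguous_addition p q n).
Proof.
move=> pD' qD' ltn_D'; split.
- apply/fsubsetP=> x; rewrite in_fsetI => /andP[/ambiguous_Sigma[]->].
    by rewrite (negPf pD').
  by rewrite (negPf qD').
- by rewrite /Lambda /rule_labels /fact_labels !imfset0 fsetU0 fset0I.
- apply/fsetP=> l; rewrite in_fsetI in_fset0; apply/negP=> /andP[lD' lA].
  by move: (ltn_D' l lD'); rewrite ltnNge (ambiguous_Lambda lA).
Qed.

Lemma target_partial (p q : proposition) (n : label) : p != q ->
  consequence (DL_partial (add empty_theory (ambiguous_addition p q n)))
    (plus Partial (q, true)).
Proof.
move=> neq_pq; set A := ambiguous_addition p q n; set D := add _ _.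
have supF t s : ~ superior D t s.
  by move/superior_only_rules => /(_ (ambiguous_only_rules p q n));
    apply: only_rules_superior.
(* With neither facts nor strict rules, every -Delta conclusion may be appended at any point. *)
have minusD x X : DL_partial D X (minus Delta x).
  split; first by rewrite facts_add !facts_only_rules // fsetU0 in_fset0.
  move=> r; rewrite inE /= fset0U.
  by case/and3P=> /ambiguous_not_strict/negPf->.
(* -Delta p is a premise of -partial p, -Delta ~q is clause (2.2) for +partial q, and -partial p
   disables the attack on q in clause (2.3). *)
exists (rcons (rcons (rcons (rcons [::] (minus Delta (p, true)))
   (minus Delta (q, false))) (minus Partial (p, true))) (plus Partial (q, true)));
  last by rewrite mem_rcons mem_head.
apply: proof_append; first apply: proof_append.
- do 2!(apply: proof_append; last exact: minusD).
  exact: proof_nil.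
- split; first by rewrite !inE eqxx.
  (* The attacker [=> ~p] has an empty body and nothing is superior to it. *)
  constructor 3; exists (ambig_against p n); split.
  + by apply: in_Rall; rewrite /= fset0U; apply/ambiguous_rulesP; constructor.
  + by move=> a; rewrite in_fset0.
  + by move=> t _; right; apply: supF.
- right; split.
  + exists (target_rule q n); last by move=> a; rewrite in_fset0.
    by apply: in_Rsd; rewrite //= fset0U; apply/ambiguous_rulesP; constructor.
  + by rewrite !mem_rcons !inE eqxx !orbT.
  (* Since p and q differ, [attack_rule] is the only rule for ~q; were they equal, [ambig_against]
     would be an attack with empty body. *)
  + move=> s; rewrite inE /= fset0U => /andP[/ambiguous_rulesP[] ->];
      rewrite xpair_eqE //= ?andbF // => /andP[eq_pq _].
      by rewrite eq_pq in neq_pq.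
    by left; exists (p, true); rewrite ?mem_rcons !inE eqxx ?orbT.
Qed.

Lemma target_not_partial_par (D' : theory) (p q : proposition) (n : label) :
  defeasible_theory D' -> p \notin Sigma D' -> q \notin Sigma D' ->
  ~ consequence (DL_partial_par (add D' (ambiguous_addition p q n)))
      (plus PartialPar (q, true)).
Proof.
move=> dD' pD' qD'; set A := ambiguous_addition p q n; set D := add _ _.
have notD x : x.1 \notin Sigma D' -> ~ P_Delta D (plus Delta x).
  move=> xD'; apply: not_plus_Delta.
    rewrite facts_add (facts_only_rules (ambiguous_only_rules p q n)) fsetU0.
    by apply: contra xD' => /fact_Sigma.
  by apply: Rs_notin_Sigma => // r; apply: ambiguous_not_strict.
(* Support takes no account of [=> ~p]: only a strict proof of ~p could block it, and p is fresh. *)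
have lam_p : P_Lam D (plus Lam (p, true)).
  apply: consequence_seq1; right; split; last exact: notD.
  exists (ambig_for p n); last by move=> a; rewrite in_fset0.
  apply: in_Rsd; rewrite // in_fsetU; apply/orP; right.
  by apply/ambiguous_rulesP; constructor.
case/consequence_last_step=> P [/notD|[_ _ att]]; first exact.
case: (att (attack_rule p q n)) => [|[a]|[t [_ /superior_only_rules sup _]]].
- apply: in_Rall; rewrite in_fsetU; apply/orP; right.
  by apply/ambiguous_rulesP; constructor.
- by rewrite inE => /eqP->.
(* A rule superior to [attack_rule] in the sum would be so already in D', making [attack_rule] a
   rule of D' and q a proposition of D'. *)
- have [_ /head_Sigma/=] := sup_rules dD' (sup (ambiguous_only_rules p q n)).
  by rewrite (negPf qD').
Qed.

Theorem theorem4 :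
  exists D : theory, defeasible_theory D /\
    forall D' : theory, defeasible_theory D' -> ~ simulated_by D D'.
Proof.
exists empty_theory; split; first exact: empty_theory_defeasible.
move=> D' dD' sim.
(* The bound p is strict, so p and p+1 are both fresh and distinct. *)
have [p ltp] := fset_nat_bounded (Sigma D').
have [n ltn] := fset_nat_bounded (Lambda D').
have pD' : p \notin Sigma D' by apply/negP=> /ltp; rewrite ltnn.
have qD' : p.+1 \notin Sigma D' by apply/negP=> /ltp; rewrite ltnNge leqnSn.
have [|_ [to_par _]] := sim (ambiguous_addition p p.+1 n)
  (ambiguous_defeasible p p.+1 n) (ambiguous_only_rules p p.+1 n)
  (ambiguous_modular pD' qD' ltn) true (p.+1, true).
  (* Simulation only constrains literals over the sum, so q must be shown to occur there. *)
  apply: (@head_Sigma _ (target_rule p.+1 n)); rewrite in_fsetU.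
  by apply/orP; right; apply/ambiguous_rulesP; constructor.
apply: (target_not_partial_par dD' pD' qD').
by apply/to_par/target_partial; rewrite ltn_eqF.
Qed.
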